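(* Let $L$ be a finite-dimensional Lie algebra over a field $\mathbb{F}$. Then a vertex of the comaximal graph $\Gamma(L)$ is isolated if and only if it is contained in the Frattini subalgebra $F(L)$ of $L$. In particular, if $F(L)=0$, then the graph $\Gamma(L)$ has no isolated vertices.
   Context: The comaximal graph $\Gamma(L)$ of a finite-dimensional Lie algebra $L$ is the simple undirected graph whose vertices are the nonzero proper Lie subalgebras of $L$, two distinct vertices $A,B$ being adjacent if and only if $\langle A,B\rangle=L$, where $\langle A,B\rangle$ denotes the Lie subalgebra generated by $A\cup B$. The Frattini subalgebra $F(L)$ is the intersection of all maximal (proper) subalgebras of $L$ (with $F(L)=L$ if $L$ has no maximal subalgebras). A vertex is isolated if it is adjacent to no vertex. *)

(* Defs.v *)
From HB Require Import structures.
From mathcomp Require Import all_boot all_order all_algebra.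
From mathcomp Require Import boolp classical_sets.

Set Implicit Arguments.
Unset Strict Implicit.
Unset Printing Implicit Defensive.

Import GRing.Theory.
Local Open Scope classical_set_scope.
Local Open Scope ring_scope.

(* The alternating law is stated as [x,x] = 0, which is stronger than
   antisymmetry in characteristic 2. *)
HB.mixin Record Lmodule_isLieAlgebra (F : fieldType) (L : Type)
    of GRing.Lmodule F L := {
  lie_bracket : L -> L -> L;
  lie_bracket_linearl : forall (y : L) (a : F) (x x' : L),
    lie_bracket (a *: x + x') y = a *: lie_bracket x y + lie_bracket x' y;
  lie_bracket_linearr : forall (x : L) (a : F) (y y' : L),
    lie_bracket x (a *: y + y') = a *: lie_bracket x y + lie_bracket x y';
  lie_bracketxx : forall x : L, lie_bracket x x = 0;
  lie_jacobi : forall x y z : L,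
    lie_bracket x (lie_bracket y z) + lie_bracket y (lie_bracket z x)
      + lie_bracket z (lie_bracket x y) = 0
}.

#[short(type="lieAlgType")]
HB.structure Definition LieAlgebra (F : fieldType) :=
  { L of Lmodule_isLieAlgebra F L & GRing.Lmodule F L }.

#[short(type="finDimLieAlgType")]
HB.structure Definition FinDimLieAlgebra (F : fieldType) :=
  { L of LieAlgebra F L & Vector F L }.

Record simple_graph := SimpleGraph {
  vert : Type;
  adj : vert -> vert -> Prop;
  adj_sym : forall u v, adj u v -> adj v u;
  adj_irrefl : forall v, ~ adj v v
}.

Definition isolated (G : simple_graph) (v : vert G) : Prop :=
  forall w : vert G, ~ adj v w.

Section Comaximal.
Variables (F : fieldType) (L : finDimLieAlgType F).
Implicit Types A B M : {vspace L}.

Definition lie_subalg A : Prop :=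
  forall x y : L, x \in A -> y \in A -> lie_bracket x y \in A.

Definition lie_gen (S : set L) : set L :=
  \bigcap_(C in [set C : {vspace L} | lie_subalg C /\ S `<=` [set` C]]) [set` C].

Definition maximal_subalg M : Prop :=
  [/\ lie_subalg M, M <> fullv &
      forall A, lie_subalg A -> (M <= A)%VS -> A = M \/ A = fullv].

(* An empty intersection is setT, so this is all of L when L has no maximal
   subalgebra. *)
Definition frattini : set L := \bigcap_(M in maximal_subalg) [set` M].

Definition comaximal_vertex A : Prop :=
  [/\ lie_subalg A, A <> 0%VS & A <> fullv].

Definition vertex : Type := {A : {vspace L} | `[< comaximal_vertex A >]}.

Definition vertex_set (A : vertex) : set L := [set` val A].

Definition comaximal_adj (A B : vertex) : Prop :=
  A <> B /\ lie_gen (vertex_set A `|` vertex_set B) = [set: L].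

Lemma comaximal_adj_sym (A B : vertex) : comaximal_adj A B -> comaximal_adj B A.
Proof. by case=> neqAB genAB; split; [exact: nesym | rewrite setUC]. Qed.

Lemma comaximal_adj_irrefl (A : vertex) : ~ comaximal_adj A A.
Proof. by case. Qed.

Definition comaximal_graph : simple_graph :=
  SimpleGraph comaximal_adj_sym comaximal_adj_irrefl.

End Comaximal.

Arguments frattini {F} L.
Arguments comaximal_graph {F} L.

(* Main.v *)
(* Any proper subalgebra lies in a maximal one (increase the dimension), and a
   maximal M together with any subalgebra not inside M generates L. So a
   neighbour B of A gives a maximal M containing B but not A, and conversely a
   maximal M not containing A is itself a neighbour of A. *)
Require Import Defs.
From mathcomp Require Import all_boot all_order all_algebra.
From mathcomp Require Import boolp classical_sets.
Local Open Scope classical_set_scope.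
Local Open Scope ring_scope.

(** Induction on the codimension of [B]: if [B] is proper but not maximal, some proper subalgebra
    strictly contains it and has smaller codimension. *)
Lemma sub_maximal_subalg (F : fieldType) (L : finDimLieAlgType F)
    (B : {vspace L}) :
  lie_subalg B -> B <> fullv -> exists2 M, maximal_subalg M & (B <= M)%VS.
Proof.
have [n] := ubnP (\dim {:L} - \dim B); elim: n B => // n IHn B leBn Blie Bprop.
have [Bmax|Bnmax] := pselect (maximal_subalg B); first by exists B.
have [C [Clie sBC CnB Cprop]] :
    exists C, [/\ lie_subalg C, (B <= C)%VS, C <> B & C <> fullv].
  apply: contrapT => noC; apply: Bnmax; split=> // C Clie sBC.
  apply: contrapT => /not_orP[CnB Cprop]; apply: noC.
  by exists C.
have [|//|//|M Mmax sCM] := IHn C; last by exists M => //; apply: subv_trans sCM.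
have ltBC : (\dim B < \dim C)%N.
  rewrite ltnNge; apply/negP => leCB; apply: CnB.
  by apply/esym/eqP; rewrite eqEdim sBC.
have leCL : (\dim C <= \dim {:L})%N by apply: dimvS; apply: subvf.
rewrite -ltnS; apply: leq_ltn_trans leBn.
(* Subtraction on [nat] is truncated, so the strict decrease also needs [\dim B < \dim {:L}], which
   follows through [C]. *)
by apply: ltn_sub2l => //; apply: leq_trans leCL.
Qed.

Lemma lie_gen_sub (F : fieldType) (L : finDimLieAlgType F)
    (S : set L) (C : {vspace L}) :
  lie_subalg C -> S `<=` [set` C] -> lie_gen S `<=` [set` C].
Proof. by move=> Clie sSC x; apply. Qed.

(** A subalgebra containing both [A] and [M] is [M] or the whole of [L] by maximality, and it cannot
    be [M] since [A] is not inside [M]. *)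
Lemma lie_gen_maximal_subalg (F : fieldType) (L : finDimLieAlgType F)
    (A M : {vspace L}) :
  maximal_subalg M -> ~ (A <= M)%VS ->
  lie_gen ([set` A] `|` [set` M]) = [set: L].
Proof.
move=> [_ _ Mmax] nsAM; apply/seteqP; split=> // x _ C [Clie sAMC].
have sAC : (A <= C)%VS by apply/subvP => y Ay; apply: sAMC; left.
have sMC : (M <= C)%VS by apply/subvP => y My; apply: sAMC; right.
have [CM|->] := Mmax C Clie sMC; last exact: memvf.
by case: nsAM; rewrite -CM.
Qed.

(** The vertex [A] rules out [M = 0]: if [0] were maximal, [A] would have to be [0] or [L]. *)
Lemma maximal_subalg_vertex (F : fieldType) (L : finDimLieAlgType F)
    (A M : {vspace L}) :
  comaximal_vertex A -> maximal_subalg M -> comaximal_vertex M.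
Proof.
move=> [Alie An0 Aprop] [Mlie Mprop Mmax]; split=> // M0.
by have [|AM|//] := Mmax A Alie; [rewrite M0 sub0v | rewrite AM M0 in An0].
Qed.

Lemma isolated_sub_frattini (F : fieldType) (L : finDimLieAlgType F)
    (A : vert (comaximal_graph L)) :
  isolated A <-> vertex_set A `<=` frattini L.
Proof.
split=> [isoA | sAF B [_ genAB]].
  have Avert : comaximal_vertex (val A) by apply/asboolP; exact: valP A.
  move=> x Ax M Mmax /=; suff /subvP -> : (val A <= M)%VS by [].
  apply: contrapT => nsAM.
  have Mvert : `[< comaximal_vertex M >].
    by apply/asboolP; apply: maximal_subalg_vertex Avert Mmax.
  apply: (isoA (exist _ M Mvert)); split.
    by move=> AM; apply: nsAM; rewrite AM.
  exact: lie_gen_maximal_subalg.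
have /asboolP[Blie _ Bprop] := valP B.
(* This [M] contains [B], and also [A] because [A] lies in every maximal subalgebra; hence it
   contains all that they generate, namely [L], although it is proper. *)
have [M Mmax sBM] := sub_maximal_subalg F L _ Blie Bprop.
have [Mlie Mprop _] := Mmax.
apply: Mprop; apply/eqP; rewrite eqEsubv subvf; apply/subvP => x _.
have : lie_gen (vertex_set A `|` vertex_set B) x by rewrite genAB.
apply: lie_gen_sub => // y [/sAF|By]; first exact.
exact: (subvP sBM).
Qed.

Theorem lemma3p2 (F : fieldType) (L : finDimLieAlgType F) :
  (forall A : vert (comaximal_graph L),
     isolated A <-> vertex_set A `<=` frattini L)
  /\ (frattini L = [set 0] ->
      forall A : vert (comaximal_graph L), ~ isolated A).
Proof.
split=> [A | F0 A /isolated_sub_frattini]; first exact: isolated_sub_frattini.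
(* An isolated vertex would lie inside [0], but vertices are nonzero. *)
rewrite F0 => sA0; have /asboolP[_ An0 _] := valP A.
apply: An0; apply/eqP; rewrite -subv0; apply/subvP => x /sA0 ->.
exact: mem0v.
Qed.
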